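(* Let $I:=\{1,\dots,m\}$, let $\Omega\subset\mathbb{R}^n$ be a nonempty, unbounded and closed set, and let $g_i\colon\mathbb{R}^n\to\mathbb{R}$, $i\in I$, be lower semicontinuous functions that are Lipschitz at infinity. Let $$S:=\{x\in\Omega : g_i(x)\le 0,\ i=1,\dots,m\}.$$ If $$0\notin\mathrm{co}\,\{\partial g_i(\infty) : i\in I\}+N(\infty;\Omega),$$ then $S$ has an error bound at infinity, i.e., there exist $\alpha>0$ and $R>0$ such that $$d(x;S)\le\alpha\sum_{i=1}^m[g_i(x)]_+\quad\text{for all } x\in\Omega\text{ with }\|x\|>R.$$
   Context: $\mathbb{R}^n$ carries the Euclidean norm; $d(x;S):=\inf\{\|y-x\| : y\in S\}$; $[t]_+:=\max\{t,0\}$; $\mathrm{co}$ denotes the convex hull, and $\mathrm{co}\,\{\partial g_i(\infty) : i\in I\}$ is the convex hull of the union of the sets $\partial g_i(\infty)$, $i\in I$; $\mathrm{epi}\,f:=\{(x,\alpha)\in\mathbb{R}^n\times\mathbb{R} : \alpha\ge f(x)\}$. Sums of sets are Minkowski sums. A lower semicontinuous function $f\colon\mathbb{R}^n\to\mathbb{R}$ is Lipschitz at infinity if there exist $L>0$ and $R>0$ such that $|f(x)-f(x')|\le L\|x-x'\|$ for all $x,x'\in\mathbb{R}^n\setminus\mathbb{B}_R$, where $\mathbb{B}_R$ is the closed ball of radius $R$ centered at $0$. Normal cones. For $C\subset\mathbb{R}^d$ and $\bar x\in C$, the Fréchet normal cone is $\widehat N(\bar x;C):=\{v\in\mathbb{R}^d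 : \limsup_{x\to\bar x,\,x\in C}\langle v,x-\bar x\rangle/\|x-\bar x\|\le 0\}$. The limiting normal cone $N(\bar x;C)$ is the set of all $v$ for which there exist $x_k\in C$, $x_k\to\bar x$, and $v_k\in\widehat N(x_k;C)$ with $v_k\to v$. Normal cone at infinity. For an unbounded closed $\Omega\subset\mathbb{R}^n$, $N(\infty;\Omega)$ is the set of all $v$ for which there exist $x_k\in\Omega$ with $\|x_k\|\to\infty$ and $v_k\in\widehat N(x_k;\Omega)$ with $v_k\to v$. Subdifferential at infinity. For a lower semicontinuous $f\colon\mathbb{R}^n\to\mathbb{R}$, $\partial f(\infty)$ is the set of all $u\in\mathbb{R}^n$ for which there exist $x_k\in\mathbb{R}^n$ with $\|x_k\|\to\infty$ and $w_k\in N((x_k,f(x_k));\mathrm{epi}\,f)$ with $w_k\to(u,-1)$.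
   Formalization: The set S is additionally assumed nonempty; if S is empty then d(x;S) is +∞ and the claim fails, e.g. for n=1, Ω=[0,∞), m=1, g(x)=x+1. *)

(* Defs.v *)
From HB Require Import structures.
From mathcomp Require Import all_boot all_order all_algebra.
From mathcomp Require Import all_classical all_reals all_analysis.

Set Implicit Arguments.
Unset Strict Implicit.
Unset Printing Implicit Defensive.

Import Order.TTheory GRing.Theory Num.Theory.
Import numFieldNormedType.Exports.

Local Open Scope classical_set_scope.
Local Open Scope ring_scope.

(* The library norm on ['rV[R]_n] is the sup norm, hence an explicit Euclidean
   norm.  Both induce the same topology, so the library's [closed], [nbhs] and
   [-->] on ['rV[R]_n] are used unchanged. *)
Definition dotp (R : realType) (n : nat) (u v : 'rV[R]_n) : R :=
  \sum_(i < n) u ord0 i * v ord0 i.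

Definition enorm (R : realType) (n : nat) (u : 'rV[R]_n) : R :=
  Num.sqrt (dotp u u).

(* Extended-real valued: the distance to the empty set is [+oo]. *)
Definition edistance (R : realType) (n : nat) (x : 'rV[R]_n)
    (S : set 'rV[R]_n) : \bar R :=
  ereal_inf [set (enorm (y - x))%:E | y in S].

Definition unbounded (R : realType) (n : nat) (A : set 'rV[R]_n) : Prop :=
  forall M : R, exists2 x, A x & M < enorm x.

(* [smallest C G] is the intersection of all supersets of [G] satisfying [C]. *)
Definition convex_hull (R : realType) (n : nat) (A : set 'rV[R]_n) :
    set 'rV[R]_n :=
  smallest (@convex_set R 'rV[R]_n) A.

Definition minkowski_sum (R : realType) (n : nat) (A B : set 'rV[R]_n) :
    set 'rV[R]_n :=
  [set a + b | a in A & b in B].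

(* [R^n * R] is identified with [R^(n+1)], so that the normal cones below apply
   to epigraphs. *)
Definition rV_pair (R : realType) (n : nat) (x : 'rV[R]_n) (a : R) :
    'rV[R]_(n + 1) :=
  row_mx x (a%:M : 'rV[R]_1).

Definition epi (R : realType) (n : nat) (f : 'rV[R]_n -> R) :
    set 'rV[R]_(n + 1) :=
  [set z | exists x a, f x <= a /\ z = rV_pair x a].

(* The limsup ranges over the points of [C] other than [xbar]; when [xbar] is
   isolated in [C] it is [-oo] and the cone is the whole space. *)
Definition frechet_normal (R : realType) (d : nat) (xbar : 'rV[R]_d)
    (C : set 'rV[R]_d) : set 'rV[R]_d :=
  [set v | (limf_esup
     (fun x : 'rV[R]_d => (dotp v (x - xbar) / enorm (x - xbar))%:E)
     (within C xbar^') <= 0)%E].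

Definition limiting_normal (R : realType) (d : nat) (xbar : 'rV[R]_d)
    (C : set 'rV[R]_d) : set 'rV[R]_d :=
  [set v | exists (x_ v_ : nat -> 'rV[R]_d),
    [/\ forall k, C (x_ k),
        x_ @ \oo --> xbar,
        forall k, frechet_normal (x_ k) C (v_ k)
      & v_ @ \oo --> v]].

Definition normal_at_infinity (R : realType) (n : nat)
    (Omega : set 'rV[R]_n) : set 'rV[R]_n :=
  [set v | exists (x_ v_ : nat -> 'rV[R]_n),
    [/\ forall k, Omega (x_ k),
        enorm (x_ k) @[k --> \oo] --> +oo,
        forall k, frechet_normal (x_ k) Omega (v_ k)
      & v_ @ \oo --> v]].

Definition subdiff_at_infinity (R : realType) (n : nat)
    (f : 'rV[R]_n -> R) : set 'rV[R]_n :=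
  [set u | exists (x_ : nat -> 'rV[R]_n) (w_ : nat -> 'rV[R]_(n + 1)),
    [/\ enorm (x_ k) @[k --> \oo] --> +oo,
        forall k, limiting_normal (rV_pair (x_ k) (f (x_ k))) (epi f) (w_ k)
      & w_ @ \oo --> rV_pair u (-1)]].

Definition lipschitz_at_infinity (R : realType) (n : nat)
    (f : 'rV[R]_n -> R) : Prop :=
  exists L rho : R, [/\ 0 < L, 0 < rho &
    forall x x', rho < enorm x -> rho < enorm x' ->
      `|f x - f x'| <= L * enorm (x - x')].

Definition constraint_set (R : realType) (m n : nat) (Omega : set 'rV[R]_n)
    (g : 'I_m -> 'rV[R]_n -> R) : set 'rV[R]_n :=
  [set x | Omega x /\ forall i, g i x <= 0].

Definition error_bound_at_infinity (R : realType) (m n : nat)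
    (Omega : set 'rV[R]_n) (g : 'I_m -> 'rV[R]_n -> R) : Prop :=
  exists alpha rho : R, [/\ 0 < alpha, 0 < rho &
    forall x, Omega x -> rho < enorm x ->
      (edistance x (constraint_set Omega g)
         <= (alpha * \sum_(i < m) Num.max (g i x) 0)%:E)%E].

(* Main.v *)
Require Import Defs.
From HB Require Import structures.
From mathcomp Require Import all_boot all_order all_algebra.
From mathcomp Require Import all_classical all_reals all_analysis.
From mathcomp Require Import ring lra.

Import Order.TTheory GRing.Theory Num.Theory.
Import numFieldNormedType.Exports.

Local Open Scope classical_set_scope.
Local Open Scope ring_scope.

(** Suppose that the error bound fails for every constant. Then there are points
    [x0] of [Omega], arbitrarily far out, whose distance to the constraint set
    exceeds any prescribed multiple of their total violation
    [eps = \sum_i (g i x0)_+]. A penalised minimisation near [x0] produces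
    approximate multipliers: points [x] and [z i] near [x0], a normal [v] to
    [Omega] at [x], subgradients [w i] of [g i] at [z i] and convex coefficients
    [mu i] with [v + \sum_i mu i *: w i] as small as desired. Everything is
    bounded because the [g i] share a Lipschitz constant far out, so a limit
    exists, and it writes [0] as an element of the convex hull of the
    subdifferentials at infinity plus a normal at infinity. This contradicts the
    qualification condition.

    The minimisation carries the weight ([approximate_multipliers]). The function
    minimised is
    [sqrt (\sum_i (g i (z i))_+^2) + p \sum_i |x - z i|^2 + c |x - x0|^2],
    over [x] in [Omega] and all [z i], in balls around [x0] so that minimisers
    exist by compactness. Three features make its optimality conditions
    elementary. Each constraint has its own variable [z i], so the conditions
    separate without a sum rule. The anchor [c |x - x0|^2] is smooth, so it enters
    with its gradient, which is at most [4 eps / lam] for a ball of radius [lam].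
    The Euclidean norm of the positive parts is smooth where it is positive, so
    neither a max rule nor a case distinction at [g i (z i) = 0] arises
    ([pos_part_subgradient]); positivity holds because the ball around [x0]
    misses the constraint set. All the resulting normals and subgradients are
    proximal, that is, have quadratic error terms, hence are Frechet normals to
    [Omega] and to the epigraphs. *)

(** * Euclidean geometry of row vectors *)

Section EuclideanSpace.
Context {R : realType} {n : nat}.
Implicit Types (u v w x y : 'rV[R]_n) (a b : R).

Lemma dotpC u v : dotp u v = dotp v u.
Proof. by apply: eq_bigr => i _; rewrite mulrC. Qed.

Lemma dotpDl u v w : dotp (u + v) w = dotp u w + dotp v w.
Proof. by rewrite -big_split; apply: eq_bigr => i _; rewrite mxE mulrDl. Qed.

Lemma dotpZl a u v : dotp (a *: u) v = a * dotp u v.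
Proof.
by rewrite /dotp mulr_sumr; apply: eq_bigr => i _; rewrite mxE mulrA.
Qed.

Lemma dotpNl u v : dotp (- u) v = - dotp u v.
Proof. by rewrite -scaleN1r dotpZl mulN1r. Qed.

Lemma dotpDr u v w : dotp w (u + v) = dotp w u + dotp w v.
Proof. by rewrite dotpC dotpDl !(dotpC w). Qed.

Lemma dotpZr a u v : dotp v (a *: u) = a * dotp v u.
Proof. by rewrite dotpC dotpZl dotpC. Qed.

Lemma dotpNr u v : dotp v (- u) = - dotp v u.
Proof. by rewrite dotpC dotpNl dotpC. Qed.

Lemma dotp0l u : dotp 0 u = 0.
Proof. by rewrite -(scale0r 0) dotpZl mul0r. Qed.

Lemma dotp0r u : dotp u 0 = 0.
Proof. by rewrite dotpC dotp0l. Qed.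

Definition dotpE := (dotpDl, dotpDr, dotpNl, dotpNr, dotpZl, dotpZr).

Lemma dotp_suml (I : Type) (s : seq I) (P : pred I) (f : I -> 'rV[R]_n) u :
  dotp (\sum_(i <- s | P i) f i) u = \sum_(i <- s | P i) dotp (f i) u.
Proof.
by elim/big_rec2: _ => [|i a b _ <-]; [exact: dotp0l | rewrite dotpDl].
Qed.

Lemma dotp_ge0 u : 0 <= dotp u u.
Proof. by apply: sumr_ge0 => i _; rewrite -expr2 sqr_ge0. Qed.

Lemma dotp_eq0 u : dotp u u = 0 -> u = 0.
Proof.
move=> u0; apply/rowP => i; rewrite mxE.
have /(_ i isT)/eqP := psumr_eq0P (fun i _ => sqr_ge0 (u ord0 i)) u0.
by rewrite sqrf_eq0 => /eqP.
Qed.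

Lemma sqr_enorm u : enorm u ^+ 2 = dotp u u.
Proof. by rewrite sqr_sqrtr// dotp_ge0. Qed.

Lemma enorm_ge0 u : 0 <= enorm u.
Proof. exact: sqrtr_ge0. Qed.

Lemma enorm0 : enorm (0 : 'rV[R]_n) = 0.
Proof. by rewrite /enorm dotp0l sqrtr0. Qed.

Lemma enorm_eq0 u : enorm u = 0 -> u = 0.
Proof. by move=> u0; apply: dotp_eq0; rewrite -sqr_enorm u0 expr0n. Qed.

Lemma enormZ a u : enorm (a *: u) = `|a| * enorm u.
Proof.
by rewrite /enorm dotpZl dotpZr mulrA -expr2 sqrtrM ?sqr_ge0// sqrtr_sqr.
Qed.

Lemma enormN u : enorm (- u) = enorm u.
Proof. by rewrite /enorm dotpNl dotpNr opprK. Qed.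

Lemma enormBC u v : enorm (u - v) = enorm (v - u).
Proof. by rewrite -enormN opprB. Qed.

Lemma le_enorm u a : 0 <= a -> dotp u u <= a ^+ 2 -> enorm u <= a.
Proof. by move=> a0; rewrite -sqr_enorm ler_sqr ?nnegrE ?enorm_ge0. Qed.

(** Expand the square of [|v| u - |u| v]. *)
Lemma cauchy_schwarz u v : dotp u v <= enorm u * enorm v.
Proof.
have [/enorm_eq0 ->|u0] := eqVneq (enorm u) 0.
  by rewrite dotp0l enorm0 mul0r.
have [/enorm_eq0 ->|v0] := eqVneq (enorm v) 0.
  by rewrite dotp0r enorm0 mulr0.
have uv0 : 0 < enorm u * enorm v.
  by rewrite mulr_gt0// lt_neqAle eq_sym ?u0 ?v0 enorm_ge0.
have := dotp_ge0 (enorm v *: u - enorm u *: v).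
rewrite !dotpE -!sqr_enorm (dotpC v u) => uv.
rewrite -(ler_pM2l uv0); nra.
Qed.

Lemma enormD u v : enorm (u + v) <= enorm u + enorm v.
Proof.
apply: le_enorm; first by rewrite addr_ge0 ?enorm_ge0.
have := cauchy_schwarz u v.
rewrite !dotpE -!sqr_enorm (dotpC v u); nra.
Qed.

Lemma enormB u v : enorm u - enorm v <= enorm (u - v).
Proof. by rewrite lerBlDr -{1}(subrK v u) enormD. Qed.

Lemma norm_coord_le u i : `|u ord0 i| <= enorm u.
Proof.
rewrite -sqrtr_sqr ler_wsqrtr// /dotp (bigD1 i)//= -expr2 lerDl.
by apply: sumr_ge0 => j _; rewrite -expr2 sqr_ge0.
Qed.

(** The topology on row vectors comes from the sup norm; together with the
    continuity of [enorm] this comparison transfers Euclidean estimates to it. *)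
Lemma norm_le_enorm u : `|u| <= enorm u.
Proof.
rewrite {1}/Num.norm/= mx_normrE; apply/bigmax_leP.
split; first exact: enorm_ge0.
by move=> [i j] _; rewrite ord1 norm_coord_le.
Qed.

Lemma cvg_rV (T : Type) (F : set_system T) {FF : Filter F}
    (f : T -> 'rV[R]_n) v :
  (forall i, f t ord0 i @[t --> F] --> v ord0 i) <-> f @ F --> v.
Proof.
split => [fv|fv i]; last first.
  exact: (cvg_comp f (fun u : 'rV[R]_n => u ord0 i) fv
    (@coord_continuous R 1 n ord0 i v)).
apply/cvgrPdist_lt => e e0.
have: \forall t \near F, forall i, `|v ord0 i - f t ord0 i| < e.
  apply: filter_forall => i; have /cvgrPdist_lt := fv i; exact.
apply: filterS => t vf; rewrite {1}/Num.norm/= mx_normrE.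
by apply/bigmax_ltP; split => // -[i j] _; rewrite ord1/= !mxE vf.
Qed.

Lemma cvg_dotp (T : Type) (F : set_system T) {FF : Filter F}
    (f g : T -> 'rV[R]_n) u v :
  f @ F --> u -> g @ F --> v -> dotp (f t) (g t) @[t --> F] --> dotp u v.
Proof.
move=> /cvg_rV fu /cvg_rV gv; rewrite /dotp.
by apply: cvg_big => [|i _]; [exact: add_continuous | apply: cvgM].
Qed.

Lemma cvg_enorm (T : Type) (F : set_system T) {FF : Filter F}
    (f : T -> 'rV[R]_n) u : f @ F --> u -> enorm (f t) @[t --> F] --> enorm u.
Proof.
move=> fu; exact: (cvg_comp _ (@Num.sqrt R) (cvg_dotp _ _ _ _ _ _ fu fu)
  (@sqrt_continuous R _)).
Qed.

Lemma continuous_enormB x : continuous (fun y => enorm (y - x)).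
Proof. move=> y; apply: (@cvg_enorm _ (nbhs y) _ (fun z => z - x) (y - x)).
by apply: cvgB; [exact: cvg_id | exact: cvg_cst]. Qed.

Lemma near_enormB x (r : R) : 0 < r -> \forall y \near x, enorm (y - x) < r.
Proof.
move=> r0; have := continuous_enormB x x; rewrite /continuous_at subrr enorm0.
by move/cvgr_lt; apply.
Qed.

Lemma cvg_of_enorm (T : Type) (F : set_system T) {FF : Filter F}
    (f : T -> 'rV[R]_n) u :
  enorm (f t - u) @[t --> F] --> (0 : R) -> f @ F --> u.
Proof.
move=> /cvgrPdist_lt fu; apply/cvgrPdist_lt => e /fu; apply: filterS => t.
rewrite sub0r normrN ger0_norm ?enorm_ge0// distrC.
by apply: le_lt_trans (norm_le_enorm _).
Qed.

Lemma closed_enorm_ball x (r : R) : closed [set y | enorm (y - x) <= r].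
Proof.
by apply: (closed_comp _ (@closed_le R r)) => y _; exact: continuous_enormB.
Qed.

Lemma compact_enorm_ball x (r : R) : compact [set y | enorm (y - x) <= r].
Proof.
apply: bounded_closed_compact; last exact: closed_enorm_ball.
exists (`|x| + r); split; first exact: num_real.
move=> M xM y /= yx; apply: le_trans (ltW xM).
rewrite -{1}(subrKC x y) (le_trans (ler_normD _ _))// lerD2l.
by rewrite (le_trans (norm_le_enorm _)).
Qed.

End EuclideanSpace.

(** * Proximal normals and subgradients *)

Section VariationalGeometry.
Context {R : realType}.

(** Normals with a quadratic error estimate. They are the ones produced by
    minimising a function plus a smooth quadratic penalty, they scale without
    any limit argument, and they are Frechet normals. *)
Definition proximal_normal {n} (x : 'rV[R]_n) (C : set 'rV[R]_n) :
    set 'rV[R]_n :=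
  [set v | exists K r : R, [/\ 0 <= K, 0 < r &
    forall y, C y -> enorm (y - x) < r ->
      dotp v (y - x) <= K * dotp (y - x) (y - x)]].

Definition proximal_subgradient {n} (f : 'rV[R]_n -> R) (x : 'rV[R]_n) :
    set 'rV[R]_n :=
  [set w | exists K r : R, [/\ 0 <= K, 0 < r &
    forall y, enorm (y - x) < r ->
      dotp w (y - x) <= f y - f x + K * dotp (y - x) (y - x)]].

Lemma proximal_normalZ {n} (x : 'rV[R]_n) C v (a : R) :
  0 <= a -> proximal_normal x C v -> proximal_normal x C (a *: v).
Proof.
move=> a0 [K [r [K0 r0 Kr]]]; exists (a * K), r; split=> //.
  exact: mulr_ge0.
by move=> y Cy yr; rewrite dotpZl -mulrA ler_wpM2l// Kr.
Qed.

(** Dividing the estimate [<v, y - x> <= K |y - x|^2] by [|y - x|] bounds the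
    difference quotient by [K |y - x|], which tends to [0]. *)
Lemma proximal_normal_frechet {n} (x : 'rV[R]_n) C :
  proximal_normal x C `<=` frechet_normal x C.
Proof.
move=> v [K [r [K0 r0 Kr]]]; apply/lee_addgt0Pr => e e0; rewrite add0e.
have K1 : 0 < K + 1 by rewrite ltr_wpDl.
have d0 : 0 < Num.min r (e / (K + 1)) by rewrite lt_min r0 divr_gt0.
set V := [set y | [/\ C y, y != x & enorm (y - x) < Num.min r (e / (K + 1))]].
apply: (@le_trans _ _ (ereal_sup
    ((fun y => (dotp v (y - x) / enorm (y - x))%:E) @` V))).
  apply: ereal_inf_lbound; exists V => //.
  rewrite /dnbhs /within/=.
  by apply: filterS (near_enormB x _ d0) => y yd yx Cy; split.
apply: ge_ereal_sup => _ [y [Cy yx +] <-]; rewrite lt_min => /andP[yr ye].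
have y0 : 0 < enorm (y - x).
  rewrite lt_neqAle enorm_ge0 andbT eq_sym; apply: contra_neq yx => /enorm_eq0.
  by move/eqP; rewrite subr_eq0 => /eqP.
rewrite lee_fin ler_pdivrMr// (le_trans (Kr _ Cy yr))// -sqr_enorm expr2 mulrA.
rewrite ler_wpM2r ?enorm_ge0//.
move: ye; rewrite ltr_pdivlMr// mulrDr mulr1 mulrC => ye.
by rewrite ltW// (le_lt_trans _ ye)// lerDl enorm_ge0.
Qed.

Lemma dotp_rV_pair {n} (u v : 'rV[R]_n) (a b : R) :
  dotp (rV_pair u a) (rV_pair v b) = dotp u v + a * b.
Proof.
rewrite /dotp big_split_ord big_ord1/=; congr +%R.
  by apply: eq_bigr => i _; rewrite !row_mxEl.
by rewrite !row_mxEr !mxE !eqxx !mulr1n.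
Qed.

Lemma rV_pairB {n} (u v : 'rV[R]_n) (a b : R) :
  rV_pair u a - rV_pair v b = rV_pair (u - v) (a - b).
Proof. by rewrite /rV_pair opp_row_mx add_row_mx raddfB. Qed.

(** A point [(y, a)] of the epigraph satisfies [a >= f y], so the functional
    [(w, -1)] increases on it by at most [<w, y - x> - (f y - f x)], which is
    quadratically small. The constant sequence then exhibits a limiting normal. *)
Lemma proximal_subgradient_epi {n} (f : 'rV[R]_n -> R) x w :
  proximal_subgradient f x w ->
  limiting_normal (rV_pair x (f x)) (epi f) (rV_pair w (-1)).
Proof.
move=> [K [r [K0 r0 Kr]]].
exists (fun=> rV_pair x (f x)), (fun=> rV_pair w (-1)); split.
- by move=> _; exists x, (f x).
- exact: cvg_cst.
- move=> _; apply: proximal_normal_frechet; exists K, r; split => //.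
  move=> _ [y [a [fya ->]]]; rewrite rV_pairB => yr.
  rewrite !dotp_rV_pair.
  have le_pair : dotp (y - x) (y - x) <=
      dotp (y - x) (y - x) + (a - f x) * (a - f x).
    by rewrite lerDl -expr2 sqr_ge0.
  have /Kr wy : enorm (y - x) < r.
    by apply: le_lt_trans yr; rewrite ler_wsqrtr// dotp_rV_pair.
  have := ler_wpM2l K0 le_pair; lra.
- exact: cvg_cst.
Qed.

(** Test the subgradient inequality at [y = x + t w]: dividing by [t |w|] gives
    [|w| <= L + K t |w|], and [t] can be taken arbitrarily small. *)
Lemma proximal_subgradient_lipschitz {n} (f : 'rV[R]_n -> R) x w (L r : R) :
  0 <= L -> 0 < r ->
  (forall y, enorm (y - x) < r -> f y - f x <= L * enorm (y - x)) ->
  proximal_subgradient f x w -> enorm w <= L.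
Proof.
move=> L0 r0 fL [K [s [K0 s0 Ks]]]; rewrite leNgt; apply/negP => Lw.
have w0 : 0 < enorm w by exact: le_lt_trans Lw.
have K1 : 0 < K + 1 by rewrite ltr_wpDl.
(* [d] keeps both estimates valid and makes [K t |w|] smaller than [|w| - L]. *)
pose d := Num.min (Num.min r s) ((enorm w - L) / (K + 1)).
have d0 : 0 < d by rewrite !lt_min r0 s0 divr_gt0// subr_gt0.
pose t := d / 2 / enorm w.
have t0 : 0 < t by rewrite !divr_gt0.
have twE : t * enorm w = d / 2 by rewrite /t divfK ?gt_eqF.
have : t * enorm w < d by rewrite twE; lra.
rewrite !lt_min ltr_pdivlMr// => /andP[/andP[twr tws] twK].
have yxE : x + t *: w - x = t *: w by rewrite addrC addKr.
have tw : enorm (x + t *: w - x) = t * enorm w.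
  by rewrite yxE enormZ gtr0_norm.
have := fL (x + t *: w); have := Ks (x + t *: w).
rewrite tw yxE !dotpE -sqr_enorm => /(_ tws) Kw /(_ twr) Lfw.
suff : t * enorm w * (enorm w - L) <= t * enorm w * (K * (t * enorm w)).
  by rewrite ler_pM2l ?mulr_gt0//; nra.
nra.
Qed.

End VariationalGeometry.

(** * The decoupled penalty *)

Section Penalization.
Context {R : realType} {m n : nat}.
Implicit Types (x y : 'rV[R]_n) (z : 'I_m -> 'rV[R]_n).

Lemma lipschitz_at_cvg (f : 'rV[R]_n -> R) x (L r : R) :
  0 <= L -> 0 < r ->
  (forall y, enorm (y - x) < r -> `|f y - f x| <= L * enorm (y - x)) ->
  f y @[y --> x] --> f x.
Proof.
move=> L0 r0 fL; apply/(@cvgrPdist_lt _ _ _ (nbhs x) (nbhs_filter x)) => e e0.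
have L1 : 0 < L + 1 by rewrite ltr_wpDl.
have d0 : 0 < Num.min r (e / (L + 1)) by rewrite lt_min r0 divr_gt0.
apply: (@filterS _ (nbhs x) _ _ _ _ (near_enormB x _ d0)) => y.
rewrite lt_min ltr_pdivlMr// => /andP[yr ye].
rewrite distrC (le_lt_trans (fL _ yr))// (le_lt_trans _ ye)//.
by rewrite mulrC ler_wpM2l ?enorm_ge0// lerDl.
Qed.

Lemma sum_sqr_le (I : Type) (s : seq I) (a : I -> R) :
  (forall i, 0 <= a i) ->
  \sum_(i <- s) a i ^+ 2 <= (\sum_(i <- s) a i) ^+ 2.
Proof.
move=> a0; suff [] : 0 <= \sum_(i <- s) a i /\
  \sum_(i <- s) a i ^+ 2 <= (\sum_(i <- s) a i) ^+ 2 by [].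
elim/big_rec2: _ => [|i b c _ [c0 bc]]; first by rewrite expr0n.
by have := a0 i => ai0; split; [rewrite addr_ge0 | nra].
Qed.

Lemma sqr_pos_part_le (a b : R) :
  Num.max b 0 ^+ 2 - Num.max a 0 ^+ 2 <=
    2 * Num.max a 0 * (b - a) + (b - a) ^+ 2.
Proof.
have sq := sqr_ge0 (b - a).
case: (lerP a 0) => a0; case: (lerP b 0) => b0.
- lra.
- by have := mulr_ge0_le0 (ltW b0) a0; nra.
- by have := sqr_ge0 b; nra.
- lra.
Qed.

(** This replaces the chain rule for [t |-> sqrt (A + t_+^2)], which is
    differentiable wherever it is positive, with derivative [t_+ / T]. The
    function [t_+^2] lies below the parabola
    [a_+^2 + 2 a_+ (t - a) + (t - a)^2], and the square root lies below its
    tangent at [T^2]. *)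
Lemma sqrt_pos_part_le (A a b T : R) :
  0 <= A -> 0 < T -> T ^+ 2 = A + Num.max a 0 ^+ 2 ->
  Num.sqrt (A + Num.max b 0 ^+ 2) <=
    T + Num.max a 0 / T * (b - a) + (b - a) ^+ 2 / (2 * T).
Proof.
move=> A0 T0 TE; set s := Num.sqrt _.
have sT : s ^+ 2 - T ^+ 2 = Num.max b 0 ^+ 2 - Num.max a 0 ^+ 2.
  by rewrite TE sqr_sqrtr ?addr_ge0 ?sqr_ge0//; ring.
have T2 : 0 < 2 * T by rewrite mulr_gt0.
rewrite -subr_ge0 -(pmulr_rge0 _ T2).
have -> : 2 * T * (T + Num.max a 0 / T * (b - a) + (b - a) ^+ 2 / (2 * T) - s) =
    2 * T ^+ 2 + 2 * Num.max a 0 * (b - a) + (b - a) ^+ 2 - 2 * T * s.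
  by field; rewrite gt_eqF.
have := sqr_ge0 (s - T); have := sqr_pos_part_le a b; nra.
Qed.

Lemma dotp_sub_sqr x y u :
  dotp (y - u) (y - u) = dotp (x - u) (x - u) + 2 * dotp (x - u) (y - x)
    + dotp (y - x) (y - x).
Proof.
rewrite !dotpE (dotpC u y) (dotpC u x) (dotpC y x).
by ring.
Qed.

Lemma dotp_subr_sqr x y u :
  dotp (u - y) (u - y) = dotp (u - x) (u - x) - 2 * dotp (u - x) (y - x)
    + dotp (y - x) (y - x).
Proof.
rewrite !dotpE (dotpC y u) (dotpC x u) (dotpC y x).
by ring.
Qed.

(** The Euclidean norm of the vector of positive parts, each constraint being
    evaluated at its own point. Unlike the sum of the positive parts, it depends
    smoothly on the values of the constraints as long as it is positive. *)
Definition violation (g : 'I_m -> 'rV[R]_n -> R) z : R :=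
  Num.sqrt (\sum_i Num.max (g i (z i)) 0 ^+ 2).

(** Decoupling: the constraint [i] is evaluated at a separate point [z i], and
    the coefficient [p] forces [z i] to stay near [x]. Stationarity in [z i] then
    only involves [g i], and stationarity in [x] only involves the domain of [x],
    so that no sum rule for subdifferentials is called for. *)
Definition penalty (g : 'I_m -> 'rV[R]_n -> R) x0 (p c : R) x z : R :=
  violation g z + p * \sum_i dotp (x - z i) (x - z i)
    + c * dotp (x - x0) (x - x0).

Lemma violation_le_sum g z : violation g z <= \sum_i Num.max (g i (z i)) 0.
Proof.
have s0 : 0 <= \sum_i Num.max (g i (z i)) 0.
  by apply: sumr_ge0 => i _; rewrite le_max lexx orbT.
rewrite -ler_sqr ?nnegrE ?sqrtr_ge0// sqr_sqrtr.
  by apply: sum_sqr_le => i; rewrite le_max lexx orbT.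
by apply: sumr_ge0 => i _; rewrite sqr_ge0.
Qed.

Lemma exists_penalty_minimizer (g : 'I_m -> 'rV[R]_n -> R) x0 (p c : R)
    (A B : set 'rV[R]_n) :
  compact A -> compact B -> A !=set0 -> B !=set0 ->
  (forall i y, B y -> g i u @[u --> y] --> g i y) ->
  exists x z, [/\ A x, forall i, B (z i) &
    forall x' z', A x' -> (forall i, B (z' i)) ->
      penalty g x0 p c x z <= penalty g x0 p c x' z'].
Proof.
move=> cA cB [a Aa] [b Bb] cg.
pose Z := prod_topology (fun _ : 'I_m => 'rV[R]_n).
pose K := A `*` [set z : Z | forall i, B (z i)].
have cK : compact K.
  by apply: compact_setX cA _; exact: (@tychonoff _ (fun=> 'rV[R]_n) (fun=> B)).
pose F (t : 'rV[R]_n * Z) := penalty g x0 p c t.1 t.2.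
have K0 : K !=set0 by exists (a, fun=> b); split.
have cF : {within K, continuous F}.
  apply: continuous_in_subspaceT => -[x z] /set_mem[/= Ax Bz].
  have cvg1 : t.1 @[t --> (x, z)] --> x by exact: cvg_fst.
  have cvg2 i : t.2 i @[t --> (x, z)] --> z i.
    apply: (@cvg_comp _ _ _ (@snd _ Z) (fun w : Z => w i)).
      exact: cvg_snd.
    exact: (@proj_continuous 'I_m (fun=> 'rV[R]_n) i z).
  rewrite /continuous_at /F /penalty /violation/=.
  apply: cvgD; [apply: cvgD |].
  - apply: (@cvg_comp _ _ _
      (fun t : 'rV[R]_n * Z => \sum_i Num.max (g i (t.2 i)) 0 ^+ 2)
      (@Num.sqrt R)); last exact: sqrt_continuous.
    apply: cvg_big => [|i _]; first exact: add_continuous.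
    have cmax : {for z i, continuous (fun u => Num.max (g i u) 0)}.
      by apply: (@continuous_max R _ (g i) (cst 0));
        [exact: cg | exact: cst_continuous].
    have cvgm : Num.max (g i (t.2 i)) 0 @[t --> (x, z)] -->
        Num.max (g i (z i)) 0.
      exact: (@cvg_comp _ _ _ _ (fun u => Num.max (g i u) 0)
        _ _ _ (cvg2 i) cmax).
    by rewrite !expr2; under eq_cvg do rewrite expr2; apply: cvgM.
  - apply: cvgM; first exact: cvg_cst.
    apply: cvg_big => [|i _]; first exact: add_continuous.
    by apply: cvg_dotp; apply: cvgB.
  - apply: cvgM; first exact: cvg_cst.
    by apply: cvg_dotp; apply: cvgB => //; exact: cvg_cst.
have [[x z] /set_mem[/= Ax Bz] Fmin] := compact_EVT_min K0 cK cF.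
exists x, z; split=> // x' z' Ax' Bz'.
by apply: (Fmin (x', z')); rewrite inE.
Qed.

End Penalization.

(** * Approximate multipliers *)

Section Multipliers.
Context {R : realType} {m n : nat}.
Implicit Types (x y : 'rV[R]_n) (z : 'I_m -> 'rV[R]_n).

(** Stationarity in a single point [z i]. Here [A] collects the squared
    violations of the other constraints. The tangent bound for the square root
    turns minimality into [<u, y - y0> <= l (f y - f y0) + K |y - y0|^2] with
    [u = 2 p (x - y0)] and [l = (f y0)_+ / T]. If [l > 0], then [u / l] is a
    proximal subgradient of [f]; if [l = 0], then [u] is one of the zero
    function, hence vanishes. *)
Lemma pos_part_subgradient (f : 'rV[R]_n -> R) x y0 (A T p L r : R) :
  0 <= A -> 0 < T -> T ^+ 2 = A + Num.max (f y0) 0 ^+ 2 ->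
  0 <= p -> 0 <= L -> 0 < r ->
  (forall y, enorm (y - y0) < r -> `|f y - f y0| <= L * enorm (y - y0)) ->
  (forall y, enorm (y - y0) < r ->
    T + p * dotp (x - y0) (x - y0) <=
      Num.sqrt (A + Num.max (f y) 0 ^+ 2) + p * dotp (x - y) (x - y)) ->
  exists w, [/\ (2 * p) *: (x - y0) = (Num.max (f y0) 0 / T) *: w,
    0 < Num.max (f y0) 0 / T -> proximal_subgradient f y0 w & enorm w <= L].
Proof.
move=> A0 T0 TE p0 L0 r0 fL fmin.
set u := (2 * p) *: (x - y0); set l := Num.max (f y0) 0 / T.
have l0 : 0 <= l by rewrite divr_ge0 ?(ltW T0)// le_max lexx orbT.
(* [p] is the curvature of the penalty; the second term comes from the error
   [(f y - f y0)^2 / (2 T)] in the tangent bound. *)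
pose K := p + L ^+ 2 / (2 * T).
have K0 : 0 <= K by rewrite addr_ge0// divr_ge0 ?sqr_ge0// mulr_ge0// ltW.
have uK y : enorm (y - y0) < r ->
    dotp u (y - y0) <= l * (f y - f y0) + K * dotp (y - y0) (y - y0).
  move=> yr; have := fmin y yr; have := fL y yr.
  have := sqrt_pos_part_le _ (f y0) (f y) T A0 T0 TE.
  rewrite -/l (dotp_subr_sqr y0 y x) => ub lip.
  have quad : (f y - f y0) ^+ 2 / (2 * T) <=
      L ^+ 2 / (2 * T) * dotp (y - y0) (y - y0).
    rewrite [leRHS]mulrAC ler_pM2r ?invr_gt0 ?mulr_gt0// -sqr_enorm -exprMn.
    rewrite -[leLHS]real_normK ?num_real// ler_sqr ?nnegrE//.
    by rewrite mulr_ge0 ?enorm_ge0.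
  by rewrite /u dotpZl /K; lra.
have [l_eq0|l_neq0] := eqVneq l 0.
  have u0 : u = 0.
    apply: enorm_eq0; apply/eqP; rewrite eq_le enorm_ge0 andbT.
    apply: (@proximal_subgradient_lipschitz R n (fun=> 0) y0 u 0 r) => //.
      by move=> y _; rewrite subrr mul0r.
    by exists K, r; split => // y /uK; rewrite l_eq0 mul0r subrr.
  exists 0; rewrite u0 scaler0 enorm0; split => //.
  by rewrite -/l l_eq0 ltxx.
have l_gt0 : 0 < l by rewrite lt_neqAle eq_sym l_neq0.
have prox : proximal_subgradient f y0 (l^-1 *: u).
  exists (l^-1 * K), r; split => //; first by rewrite mulr_ge0// invr_ge0.
  move=> y /uK uy; rewrite dotpZl -(ler_pM2l l_gt0) mulrDr !mulrA.
  by rewrite !divff// !mul1r.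
exists (l^-1 *: u); split => //; first by rewrite scalerA divff// scale1r.
apply: (proximal_subgradient_lipschitz _ _ _ _ _ L0 r0 _ prox) => y /fL.
by apply: le_trans; exact: ler_norm.
Qed.

(** Optimality conditions for the total violation on [Omega], up to [e], with
    normalised multipliers; each subgradient is taken at a point of its own. *)
Definition approx_stationary (Omega : set 'rV[R]_n)
    (g : 'I_m -> 'rV[R]_n -> R) (L e : R) x z : Prop :=
  exists (v : 'rV[R]_n) (w : 'I_m -> 'rV[R]_n) (mu : 'I_m -> R),
    [/\ Omega x, proximal_normal x Omega v, forall i, enorm (w i) <= L,
        forall i, 0 < mu i -> proximal_subgradient (g i) (z i) (w i) &
        [/\ forall i, 0 <= mu i, \sum_i mu i = 1 &
            enorm (v + \sum_i mu i *: w i) <= e]].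

(** The heart of the proof. Minimise the penalty over [x] in [Omega] within
    [lam] of [x0] and over [z i] within [lam + 1] of [x0]. Its value at [x0] is
    at most [eps = \sum_i (g i x0)_+], so the minimiser is interior to both
    balls for the chosen [c] and [p]. As the ball around [x0] misses the
    constraint set, the violation stays positive on it, and a large [p] keeps
    the decoupled violation positive too. Stationarity in each [z i] gives
    [2 p (x - z i) = l i *: w i]; stationarity in [x] says that
    [- \sum_i 2 p (x - z i) - 2 c (x - x0)] is normal to [Omega]. Since the
    violation is a Euclidean norm, it is at most the sum of its coordinates, so
    [\sum_i l i >= 1] and one may normalise. The residual
    [2 c |x - x0|] is at most [4 eps / lam]. *)
Lemma approximate_multipliers (Omega : set 'rV[R]_n)
    (g : 'I_m -> 'rV[R]_n -> R) (L rho lam : R) x0 :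
  closed Omega -> Omega x0 -> 0 <= L -> 0 < lam ->
  (forall i x x', rho < enorm x -> rho < enorm x' ->
    `|g i x - g i x'| <= L * enorm (x - x')) ->
  rho < enorm x0 - lam - 1 ->
  (forall x, constraint_set Omega g x -> lam < enorm (x - x0)) ->
  exists x z, [/\ enorm (x - x0) <= lam, forall i, enorm (z i - x0) <= lam + 1 &
    approx_stationary Omega g L (4 * (\sum_i Num.max (g i x0) 0) / lam) x z].
Proof.
move=> cO Ox0 L0 lam0 gL x0far Sfar.
have maxr_ge0 (a : R) : 0 <= Num.max a 0 by rewrite le_max lexx orbT.
pose h y := \sum_i Num.max (g i y) 0.
have h_ge0 y : 0 <= h y by exact: sumr_ge0.
pose A := Omega `&` [set y | enorm (y - x0) <= lam].
pose B := [set y | enorm (y - x0) <= lam + 1].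
have Bfar y : B y -> rho < enorm y.
  by rewrite /B/= enormBC => yB; have := enormB x0 y; lra.
have AB y : A y -> B y by rewrite /A /B/= => -[_]; lra.
have Ax0 : A x0 by split => //=; rewrite subrr enorm0 ltW.
have cA : compact A.
  apply: (@subclosed_compact _ _ [set y | enorm (y - x0) <= lam]).
  - exact: closedI cO (closed_enorm_ball _ _).
  - exact: compact_enorm_ball.
  - by move=> y [].
have far_near y : rho < enorm y -> exists2 r, 0 < r &
    forall y', enorm (y' - y) < r -> rho < enorm y'.
  move=> yfar; exists (enorm y - rho); first by rewrite subr_gt0.
  by move=> y'; rewrite enormBC => y'r; have := enormB y y'; lra.
have cg i y : B y -> g i u @[u --> y] --> g i y.
  move=> /Bfar yfar; have [r r0 rfar] := far_near _ yfar.
  by apply: (lipschitz_at_cvg _ _ L r) => // y' /rfar y'far; exact: gL.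
have h_gt0 y : A y -> 0 < h y.
  move=> [Oy yx0]; rewrite lt_neqAle h_ge0 andbT eq_sym; apply/negP => /eqP h0.
  have : constraint_set Omega g y.
    split=> // i.
    have /(_ i isT) := psumr_eq0P (fun i _ => maxr_ge0 (g i y)) h0.
    by move=> gi0; rewrite -gi0 le_max lexx.
  by move/Sfar; rewrite ltNge => /negP; apply.
have [del del0 hdel] : exists2 del, 0 < del & forall y, A y -> del <= h y.
  have A0 : A !=set0 by exists x0.
  have ch : {within A, continuous h}.
    apply: continuous_in_subspaceT => y /set_mem /AB yB.
    apply: (cvg_big (add_continuous (s:=R)) (nbhs_filter y)) => i _.
    by apply: (@continuous_max R _ (g i) (cst 0));
      [exact: cg | exact: cst_continuous].
  have [y /set_mem Ay ymin] := compact_EVT_min A0 cA ch.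
  by exists (h y); [exact: h_gt0 | move=> y' Ay'; apply: ymin; rewrite inE].
(* If every [z i] is within [eta] of [x] and no [g i (z i)] is positive, then
   [h x <= m L eta < del], which contradicts the choice of [del]. *)
pose eta := Num.min 1 (del / (m%:R * L + 1)).
have mL1 : 0 < m%:R * L + 1 by rewrite ltr_wpDl// mulr_ge0.
have eta0 : 0 < eta by rewrite lt_min ltr01 divr_gt0.
pose eps := h x0.
have eps0 : 0 < eps by exact: h_gt0.
(* The factor 2 makes the bounds [|z i - x| < eta] and [|x - x0| < lam] strict:
   each quadratic term of the penalty is at most [eps] at the minimiser. *)
pose p := 2 * eps / eta ^+ 2.
have p0 : 0 < p by rewrite divr_gt0 ?exprn_gt0// mulr_gt0.
pose c := 2 * eps / lam ^+ 2.
have c0 : 0 < c by rewrite divr_gt0 ?exprn_gt0// mulr_gt0.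
have B0 : B !=set0 by exists x0; exact: AB.
have [x [z [Ax Bz xzmin]]] := exists_penalty_minimizer g x0 p c A B cA
  (compact_enorm_ball _ _) (ex_intro _ x0 Ax0) B0 cg.
have [Ox xx0] := Ax.
set T := violation g z.
have T_ge0 : 0 <= T by exact: sqrtr_ge0.
have penalty_le : penalty g x0 p c x z <= eps.
  apply: le_trans (xzmin x0 (fun=> x0) Ax0 (fun=> AB _ Ax0)) _.
  rewrite /penalty subrr dotp0l mulr0 big1 ?mulr0 ?addr0//.
  exact: violation_le_sum.
have sum_dotp_ge0 : 0 <= \sum_i dotp (x - z i) (x - z i).
  by apply: sumr_ge0 => i _; exact: dotp_ge0.
have xlt : enorm (x - x0) < lam.
  suff : enorm (x - x0) ^+ 2 < lam ^+ 2.
    by rewrite ltr_sqr ?nnegrE ?enorm_ge0// ltW.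
  rewrite sqr_enorm -(ltr_pM2l c0) {2}/c divfK ?expf_neq0 ?gt_eqF//.
  have : c * dotp (x - x0) (x - x0) <= eps.
    apply: le_trans penalty_le; rewrite /penalty lerDr addr_ge0//.
    by rewrite mulr_ge0 ?(ltW p0).
  lra.
have zlt i : enorm (z i - x) < eta.
  suff : enorm (z i - x) ^+ 2 < eta ^+ 2.
    by rewrite ltr_sqr ?nnegrE ?enorm_ge0// ltW.
  rewrite enormBC sqr_enorm -(ltr_pM2l p0) {2}/p divfK ?expf_neq0 ?gt_eqF//.
  have : p * dotp (x - z i) (x - z i) <= eps.
    apply: le_trans penalty_le; rewrite /penalty -addrA addrCA.
    apply: ler_wpDr; first by rewrite addr_ge0// mulr_ge0 ?(ltW c0) ?dotp_ge0.
    rewrite ler_pM2l// (bigD1 i)//= lerDl.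
    by apply: sumr_ge0 => j _; exact: dotp_ge0.
  lra.
have zfar i : rho < enorm (z i) by exact: Bfar.
have xfar : rho < enorm x by apply: Bfar; exact: AB.
have T0 : 0 < T.
  rewrite lt_neqAle T_ge0 andbT eq_sym; apply/negP => /eqP Teq0.
  have s0 : 0 <= \sum_i Num.max (g i (z i)) 0 ^+ 2.
    by apply: sumr_ge0 => i _; exact: sqr_ge0.
  have gz0 i : g i (z i) <= 0.
    have sum0 : \sum_i Num.max (g i (z i)) 0 ^+ 2 = 0.
      by rewrite -(sqr_sqrtr s0) [Num.sqrt _]Teq0 expr0n.
    have /(_ i isT)/eqP :=
      psumr_eq0P (fun i _ => sqr_ge0 (Num.max (g i (z i)) 0)) sum0.
    by rewrite sqrf_eq0 => /eqP gi0; rewrite -gi0 le_max lexx.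
  have : h x <= \sum_(i < m) L * eta.
    apply: ler_sum => i _; rewrite ge_max mulr_ge0 ?(ltW eta0)// andbT.
    have := gL i _ _ xfar (zfar i); rewrite enormBC.
    have := ler_norm (g i x - g i (z i)); have := gz0 i.
    have := ler_wpM2l L0 (ltW (zlt i)); lra.
  rewrite sumr_const card_ord -mulr_natl mulrA => hx.
  have : eta <= del / (m%:R * L + 1) by rewrite ge_min lexx orbT.
  rewrite ler_pdivlMr// => etadel; have := hdel _ Ax; nra.
pose l i := Num.max (g i (z i)) 0 / T.
have l_ge0 i : 0 <= l i by rewrite divr_ge0// ltW.
have /choice[w wP] i : exists w,
    [/\ (2 * p) *: (x - z i) = l i *: w,
        0 < l i -> proximal_subgradient (g i) (z i) w & enorm w <= L].
  pose S := \sum_(j | j != i) Num.max (g j (z j)) 0 ^+ 2.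
  have S0 : 0 <= S by apply: sumr_ge0 => j _; exact: sqr_ge0.
  have TE : T ^+ 2 = S + Num.max (g i (z i)) 0 ^+ 2.
    rewrite sqr_sqrtr; first by rewrite (bigD1 i)//= addrC.
    by apply: sumr_ge0 => j _; exact: sqr_ge0.
  have zi : enorm (z i - x0) < lam + 1.
    have := enormD (z i - x) (x - x0); rewrite addrA subrK.
    have : eta <= 1 by rewrite ge_min lexx.
    by have := zlt i; lra.
  pose r := lam + 1 - enorm (z i - x0).
  have r0 : 0 < r by rewrite subr_gt0.
  have yB y : enorm (y - z i) < r -> B y.
    rewrite /r /B/= => yr; have := enormD (y - z i) (z i - x0).
    by rewrite addrA subrK; lra.
  apply: (pos_part_subgradient (g i) x (z i) S T p L r) => //.
  - exact: ltW.
  - by move=> y /yB /Bfar yfar; apply: gL.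
  (* Moving only the [i]-th point leaves [S] and the other penalty terms fixed. *)
  move=> y /yB By; pose z' j := if j == i then y else z j.
  have Bz' j : B (z' j) by rewrite /z'; case: ifP.
  have vz' : violation g z' = Num.sqrt (S + Num.max (g i y) 0 ^+ 2).
    rewrite /violation (bigD1 i)//= /z' eqxx addrC; congr (Num.sqrt (_ + _)).
    by apply: eq_bigr => j /negPf ->.
  have := xzmin x z' Ax Bz'; rewrite /penalty lerD2r -/T vz'.
  have dz' : \sum_(j | j != i) dotp (x - z' j) (x - z' j) =
      \sum_(j | j != i) dotp (x - z j) (x - z j).
    by apply: eq_bigr => j /negPf ji; rewrite /z' ji.
  rewrite (bigD1 i)//= [X in _ <= _ + _ * X](bigD1 i)//= dz' {1 2}/z' eqxx.
  by rewrite !mulrDr !addrA lerD2r.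
have lw : \sum_i l i *: w i = (2 * p) *: \sum_i (x - z i).
  by rewrite scaler_sumr; apply: eq_bigr => i _; have [->] := wP i.
pose v0 := - (\sum_i l i *: w i) - (2 * c) *: (x - x0).
have v0E : v0 + \sum_i l i *: w i = - ((2 * c) *: (x - x0)).
  by rewrite /v0 addrC addrA subrr sub0r.
have nv0 : proximal_normal x Omega v0.
  exists (p *+ m + c), (lam - enorm (x - x0)); split.
  - by rewrite addr_ge0 ?(ltW c0)// mulrn_wge0// ltW.
  - by rewrite subr_gt0.
  move=> y Oy yr; have Ay : A y.
    split=> //=; have := enormD (y - x) (x - x0); rewrite addrA subrK; lra.
  have := xzmin y z Ay Bz; rewrite /penalty.
  have -> : \sum_i dotp (y - z i) (y - z i) = \sum_i dotp (x - z i) (x - z i)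
      + 2 * dotp (\sum_i (x - z i)) (y - x) + m%:R * dotp (y - x) (y - x).
    have -> : m%:R * dotp (y - x) (y - x) = \sum_(i < m) dotp (y - x) (y - x).
      by rewrite sumr_const card_ord mulr_natl.
    rewrite dotp_suml mulr_sumr -!big_split/=; apply: eq_bigr => i _.
    exact: dotp_sub_sqr.
  have -> : dotp v0 (y - x) = - (2 * p * dotp (\sum_i (x - z i)) (y - x))
      - 2 * c * dotp (x - x0) (y - x).
    by rewrite /v0 lw; move: (x - x0) => e; rewrite dotpDl !dotpNl !dotpZl.
  rewrite (dotp_sub_sqr x y x0) -[p *+ m]mulr_natl.
  lra.
pose Lam := \sum_i l i.
have Lam1 : 1 <= Lam.
  by rewrite /Lam -mulr_suml ler_pdivlMr// mul1r violation_le_sum.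
have Lam0 : 0 < Lam by exact: lt_le_trans Lam1.
exists x, z; split=> //.
exists (Lam^-1 *: v0), w, (fun i => l i / Lam); split.
- by [].
- by apply: proximal_normalZ => //; rewrite invr_ge0 ltW.
- by move=> i; have [] := wP i.
- move=> i; rewrite pmulr_lgt0 ?invr_gt0// => li.
  by have [_ + _] := wP i; apply.
- split.
  + by move=> i; rewrite divr_ge0// ltW.
  + by rewrite -mulr_suml divff// gt_eqF.
  + rewrite (eq_bigr (fun i => Lam^-1 *: (l i *: w i))); last first.
      by move=> i _; rewrite scalerA mulrC.
    rewrite -scaler_sumr -scalerDr v0E enormZ enormN enormZ.
    have c2 : 0 < 2 * c by rewrite (mulr_gt0 _ c0).
    rewrite gtr0_norm ?invr_gt0// (gtr0_norm c2).
    apply: (@le_trans _ _ (2 * c * enorm (x - x0))).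
      apply: ler_piMl; last by rewrite invf_le1.
      by rewrite mulr_ge0 ?enorm_ge0// ltW.
    rewrite -/(h x0) -/eps.
    have -> : 4 * eps / lam = 2 * c * lam by rewrite /c; field; rewrite gt_eqF.
    by rewrite (ler_pM2l c2).
Qed.

End Multipliers.

(** * Compactness, limits and uniform constants *)

Section Limits.
Context {R : realType}.

Lemma increasing_seq_ge (f : nat -> nat) k : increasing_seq f -> (k <= f k)%N.
Proof.
move=> finc; elim: k => // k IH; apply: leq_ltn_trans IH _.
rewrite ltnNge; apply/negP => fk; have := finc k.+1 k.
by rewrite leEnat fk ltnn.
Qed.

Lemma cvg_increasing_seq (f : nat -> nat) : increasing_seq f -> f @ \oo --> \oo.
Proof.
move=> finc A [N _ NA]; exists N => // k /= Nk; apply: NA => /=.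
exact: leq_trans Nk (increasing_seq_ge _ _ finc).
Qed.

(** Bolzano-Weierstrass applied to one scalar sequence after another. *)
Lemma bounded_common_subsequence (I : finType) (u : I -> nat -> R) (B : R) :
  (forall i k, `|u i k| <= B) ->
  exists2 f : nat -> nat, increasing_seq f & forall i, cvgn (u i \o f).
Proof.
move=> uB; suff [f finc fcv] : exists2 f : nat -> nat, increasing_seq f &
    forall i, i \in enum I -> cvgn (u i \o f).
  by exists f => // i; apply: fcv; rewrite mem_enum.
elim: (enum I) => [|i s [f finc fcv]]; first by exists id.
have bnd : bounded_fun (u i \o f).
  exists B; split; first exact: num_real.
  by move=> M BM k _ /=; rewrite (le_trans (uB _ _))// ltW.
have [h hinc hcv] := bolzano_weierstrass bnd.
exists (f \o h); first by move=> a b; rewrite /= finc -leEnat hinc.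
move=> j; rewrite inE => /predU1P[->//|/fcv uf].
apply/cvg_ex; exists (limn (u j \o f)).
exact: (cvg_comp h (u j \o f) (cvg_increasing_seq _ hinc) uf).
Qed.

Lemma cvgy_ge_nat (u : nat -> R) :
  (forall k, k%:R <= u k) -> u @ \oo --> +oo.
Proof.
move=> uk; apply: ger_cvgy; last exact: cvgr_idn.
by apply: nearW.
Qed.

Lemma convex_hull_sum {n} (A : set 'rV[R]_n) (I : finType) (mu : I -> R)
    (w : I -> 'rV[R]_n) :
  (forall i, 0 <= mu i) -> \sum_i mu i = 1 ->
  (forall i, 0 < mu i -> A (w i)) -> convex_hull A (\sum_i mu i *: w i).
Proof.
move=> mu0 mu1 Aw C [cC AC].
suff : forall s : seq I,
    (\sum_(i <- s) mu i = 0 /\ \sum_(i <- s) mu i *: w i = 0) \/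
    (0 < \sum_(i <- s) mu i /\ exists2 y, C y &
      \sum_(i <- s) mu i *: w i = (\sum_(i <- s) mu i) *: y).
  move=> /(_ (index_enum I)); rewrite mu1 => -[[/eqP]|].
    by rewrite oner_eq0.
  by move=> [_ [y Cy ->]]; rewrite scale1r.
elim=> [|i s IH]; first by left; rewrite !big_nil.
rewrite !big_cons; have [mui0|mui0] := eqVneq (mu i) 0.
  by rewrite mui0 add0r scale0r add0r.
have mui : 0 < mu i by rewrite lt_neqAle eq_sym mui0 mu0.
have Cw : C (w i) by apply: AC; exact: Aw.
right; case: IH => [[-> ->]|[S0 [y Cy ->]]].
  by rewrite !addr0; split => //; exists (w i).
set S := \sum_(i <- s) mu i in S0 *.
have M0 : 0 < mu i + S by rewrite addr_gt0.
split=> //.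
have t0 : 0 <= mu i / (mu i + S) by rewrite divr_ge0 ?ltW.
have t1 : mu i / (mu i + S) <= 1 by rewrite ler_pdivrMr// mul1r lerDl ltW.
exists ((mu i / (mu i + S)) *: w i + (1 - mu i / (mu i + S)) *: y).
  have := cC (w i) y (Itv01 t0 t1) (mem_set Cw) (mem_set Cy).
  by rewrite inE.
rewrite scalerDr !scalerA mulrC divfK ?gt_eqF//; congr (_ + _ *: _).
by field; rewrite gt_eqF.
Qed.

Lemma cvg_rV_pair {n} (f : nat -> 'rV[R]_n) (u : 'rV[R]_n) (a : R) :
  f @ \oo --> u -> rV_pair (f k) a @[k --> \oo] --> rV_pair u a.
Proof.
move=> /cvg_rV fu; apply/cvg_rV => i; rewrite /rV_pair.
case: (split_ordP i) => j ->.
  by rewrite row_mxEl; under eq_cvg do rewrite row_mxEl; exact: fu.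
by rewrite row_mxEr; under eq_cvg do rewrite row_mxEr; exact: cvg_cst.
Qed.

Lemma edistance_gt {n} (x : 'rV[R]_n) (S : set 'rV[R]_n) (r : R) :
  (r%:E < edistance x S)%E -> forall y, S y -> r < enorm (y - x).
Proof.
move=> rS y Sy; rewrite -lte_fin (lt_le_trans rS)//.
by apply: ereal_inf_lbound; exists y.
Qed.

Lemma uniform_lipschitz_at_infinity {m n} (g : 'I_m -> 'rV[R]_n -> R) :
  (forall i, lipschitz_at_infinity (g i)) ->
  exists L rho : R, [/\ 0 <= L, 0 <= rho & forall i x x',
    rho < enorm x -> rho < enorm x' ->
      `|g i x - g i x'| <= L * enorm (x - x')].
Proof.
move=> /choice[L /choice[rho gL]].
have L0 i : 0 <= L i by have [/ltW] := gL i.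
have rho0 i : 0 <= rho i by have [_ /ltW] := gL i.
exists (\sum_i L i), (\sum_i rho i); split; try exact: sumr_ge0.
move=> i x x' xfar x'far; have [_ _ gi] := gL i.
have le_sum (a : 'I_m -> R) : (forall j, 0 <= a j) -> a i <= \sum_j a j.
  by move=> a0; rewrite (bigD1 i)//= lerDl sumr_ge0.
apply: le_trans (gi x x' _ _) _.
- exact: le_lt_trans (le_sum _ rho0) xfar.
- exact: le_lt_trans (le_sum _ rho0) x'far.
- by rewrite ler_wpM2r ?enorm_ge0// le_sum.
Qed.

End Limits.

(** * Multipliers escaping to infinity *)

Section AtInfinity.
Context {R : realType} {m n : nat}.

(** If the error bound fails with constant [k + 1], some far point [x0] of
    [Omega] is at distance more than [(k + 1) eps] from the constraint set, where
    [eps] is its total violation. The choice [2 lam = (k + 1) eps] makes the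
    residual [4 eps / lam] equal to [8 / (k + 1)], and a fixed feasible point [s]
    bounds [lam] by about half of [|x0|], so the multipliers sit far out. *)
Lemma far_multipliers (Omega : set 'rV[R]_n) (g : 'I_m -> 'rV[R]_n -> R)
    (L rho : R) (k : nat) :
  closed Omega -> constraint_set Omega g !=set0 -> 0 <= L -> 0 <= rho ->
  (forall i x x', rho < enorm x -> rho < enorm x' ->
    `|g i x - g i x'| <= L * enorm (x - x')) ->
  ~ error_bound_at_infinity Omega g ->
  exists (x : 'rV[R]_n) (z : 'I_m -> 'rV[R]_n),
    [/\ k%:R <= enorm x, forall i, k%:R <= enorm (z i) &
        approx_stationary Omega g L (8 * k.+1%:R^-1) x z].
Proof.
move=> cO [s Ss] L0 rho0 gL no_bound.
(* With [2 lam < |s - x0|] this keeps the ball of radius [lam + 1] around [x0]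
   outside the ball of radius [rho + k]. *)
pose far := 2 * (rho + k%:R + 1) + enorm s.
have far0 : 0 < far.
  by rewrite ltr_wpDr ?enorm_ge0// mulr_gt0// ltr_wpDl// addr_ge0.
have [x0 [Ox0 x0far x0S]] : exists x0, [/\ Omega x0, far < enorm x0 &
    ((k.+1%:R * \sum_i Num.max (g i x0) 0)%:E
      < edistance x0 (constraint_set Omega g))%E].
  apply: contrapT => noex; apply: no_bound; exists k.+1%:R, far; split => //.
  move=> x Ox xfar; rewrite leNgt; apply/negP => xS.
  by apply: noex; exists x.
set eps := \sum_i Num.max (g i x0) 0 in x0S.
have {}x0S := edistance_gt _ _ _ x0S.
have eps_ge0 : 0 <= eps by apply: sumr_ge0 => i _; rewrite le_max lexx orbT.
have eps0 : 0 < eps.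
  rewrite lt_neqAle eps_ge0 andbT eq_sym; apply/negP => /eqP epsE.
  have : constraint_set Omega g x0.
    split=> // i.
    have max0 j : true -> 0 <= Num.max (g j x0) 0 by rewrite le_max lexx orbT.
    have /(_ i isT) gi := psumr_eq0P max0 epsE.
    by rewrite -gi le_max lexx.
  by move/x0S; rewrite subrr enorm0 epsE mulr0 ltxx.
(* Half the distance forbidden to the constraint set: the ball of radius [lam]
   misses it, while [lam] stays below about half of [|x0|]. *)
pose lam := k.+1%:R * eps / 2.
have lam0 : 0 < lam by rewrite divr_gt0// mulr_gt0.
have lam2 : k.+1%:R * eps = 2 * lam by rewrite /lam; field.
have lam_far : lam < enorm x0 - rho - k%:R - 1.
  have := x0S _ Ss; rewrite lam2; have := enormD s (- x0); rewrite enormN.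
  by rewrite /far in x0far; lra.
have k0 : 0 <= k%:R :> R by [].
have [||x [z [xx0 zx0 [v [w [mu [Ox nv wL subg [mu0 mu1 vw]]]]]]]] :=
  approximate_multipliers Omega g L rho lam x0 cO Ox0 L0 lam0 gL.
- by lra.
- by move=> y /x0S; rewrite lam2; lra.
have close (y : 'rV[R]_n) (r : R) : enorm (y - x0) <= r ->
    enorm x0 - r <= enorm y.
  by rewrite enormBC => yr; have := enormB x0 y; lra.
exists x, z; split.
- by have := close _ _ xx0; lra.
- by move=> i; have := close _ _ (zx0 i); lra.
exists v, w, mu; split=> //.
split=> //; rewrite (le_trans vw)// -/eps /lam le_eqVlt; apply/orP; left.
have k1 : 0 < k.+1%:R :> R by [].
by apply/eqP; move: k1; set k1 := k.+1%:R => k1_gt0; field; rewrite !gt_eqF.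
Qed.

(** Pass to the limit along a subsequence on which [mu] and [w] converge. The
    normals [v] need no compactness: they converge because the residual does.
    Constraints whose limit coefficient vanishes drop out of the convex
    combination, since their [w] remain bounded by [L]. *)
Lemma zero_in_sum_at_infinity (Omega : set 'rV[R]_n)
    (g : 'I_m -> 'rV[R]_n -> R) (L : R)
    (x : nat -> 'rV[R]_n) (z : nat -> 'I_m -> 'rV[R]_n) :
  (forall k, [/\ k%:R <= enorm (x k), forall i, k%:R <= enorm (z k i) &
    approx_stationary Omega g L (8 * k.+1%:R^-1) (x k) (z k)]) ->
  minkowski_sum
    (convex_hull (\bigcup_(i in [set: 'I_m]) subdiff_at_infinity (g i)))
    (normal_at_infinity Omega) 0.
Proof.
move=> xz_far.
have stat k : approx_stationary Omega g L (8 * k.+1%:R^-1) (x k) (z k).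
  by have [] := xz_far k.
have [v /choice[w /choice[mu {}stat]]] := choice stat.
pose u (i : ('I_m + 'I_m * 'I_n)%type) k : R :=
  match i with inl i => mu k i | inr (i, j) => w k i ord0 j end.
have ub i k : `|u i k| <= 1 + `|L|.
  have [_ _ wL _ [mu0 mu1 _]] := stat k.
  case: i => [i|[i j]] /=.
    rewrite ger0_norm// ler_wpDr// -mu1 (bigD1 i)//= lerDl.
    exact: sumr_ge0.
  rewrite (le_trans (norm_coord_le _ _))//.
  by rewrite (le_trans (wL i))// (le_trans (ler_norm _))// lerDr.
have [f finc fcv] := bounded_common_subsequence _ u _ ub.
have kf k : k%:R <= (f k)%:R :> R by rewrite ler_nat increasing_seq_ge.
pose mul i := limn (u (inl i) \o f).
pose wl i : 'rV[R]_n := \row_j limn (u (inr (i, j)) \o f).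
have cmu i : mu (f k) i @[k --> \oo] --> mul i by exact: (fcv (inl i)).
have cw i : w (f k) i @[k --> \oo] --> wl i.
  by apply/cvg_rV => j; rewrite mxE; exact: (fcv (inr (i, j))).
have mul0 i : 0 <= mul i.
  apply: (limr_ge (fcv (inl i))).
  by apply: nearW => k; have [_ _ _ _ [+ _ _]] := stat (f k); exact.
have csum : \sum_i mu (f k) i @[k --> \oo] --> \sum_i mul i.
  by apply: (cvg_big (add_continuous (s:=R))).
have mul1 : \sum_i mul i = 1.
  apply/esym/(cvg_unique _ _ csum) => //.
  rewrite (_ : (fun k => _) = fun=> 1); first exact: cvg_cst.
  by apply/funext => k; have [_ _ _ _ [_ + _]] := stat (f k).
pose total := \sum_i mul i *: wl i.
have ctotal : \sum_i mu (f k) i *: w (f k) i @[k --> \oo] --> total.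
  apply: (cvg_big (add_continuous (s:='rV[R]_n))) => i _.
  by apply: cvgZ.
have cresidual :
    v (f k) + \sum_i mu (f k) i *: w (f k) i @[k --> \oo] --> (0 : 'rV[R]_n).
  apply: cvg_of_enorm; apply: (@squeeze_cvgr _ _ _ _ (fun=> 0)
    (fun k => 8 * k.+1%:R^-1)).
  - apply: nearW => k; rewrite subr0 enorm_ge0/=.
    have [_ _ _ _ [_ _ /le_trans]] := stat (f k); apply.
    by rewrite ler_pM2l// lef_pV2 ?posrE// ler_nat ltnS increasing_seq_ge.
  - exact: cvg_cst.
  - by rewrite -[0 in X in _ --> X](mulr0 8); apply: cvgM;
      [exact: cvg_cst | exact: cvg_harmonic].
exists total.
  apply: convex_hull_sum => // i mui; exists i => //.
  (* While [mu (f k) i] vanishes, [w (f k) i] need not be a subgradient, so the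
     first [N] terms are dropped. *)
  have [N _ posN] : \forall k \near \oo, 0 < mu (f k) i.
    exact: (cvgr_gt _ (cmu i)).
  exists (fun k => z (f (k + N)%N) i),
    (fun k => rV_pair (w (f (k + N)%N) i) (-1)).
  split.
  - apply: cvgy_ge_nat => k; have [_ /(_ i) zk _] := xz_far (f (k + N)%N).
    apply: le_trans zk; apply: le_trans (kf _).
    by rewrite ler_nat leq_addr.
  - move=> k; apply: proximal_subgradient_epi.
    have [_ _ _ + _] := stat (f (k + N)%N); apply; apply: posN => /=.
    exact: leq_addl.
  - apply: cvg_rV_pair.
    by have := cw i; rewrite -(cvg_shiftn N).
exists (- total); last by rewrite subrr.
exists (x \o f), (v \o f); split.
- by move=> k; have [] := stat (f k).
- apply: cvgy_ge_nat => k; have [xk _ _] := xz_far (f k).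
  exact: le_trans (kf k) xk.
- by move=> k; apply: proximal_normal_frechet; have [] := stat (f k).
- rewrite -[- total]add0r.
  rewrite (_ : v \o f = fun k => (v (f k) + \sum_i mu (f k) i *: w (f k) i)
    - \sum_i mu (f k) i *: w (f k) i); first exact: cvgB.
  by apply/funext => k /=; rewrite addrK.
Qed.

End AtInfinity.

(* Nonemptiness of the constraint set is needed for the distance to it to be
   finite: with n = 1, Omega = [0, +oo[ and g x = x + 1 the constraint set is
   empty although the qualification condition 0 \notin {1} + {0} holds. *)
Theorem theorem3p3 (R : realType) (m n : nat) (Omega : set 'rV[R]_n)
    (g : 'I_m -> 'rV[R]_n -> R)
    (Omega_neq0 : Omega !=set0)
    (Omega_unbounded : unbounded Omega)
    (Omega_closed : closed Omega)
    (g_lsc : forall i, lower_semicontinuous (fun x => (g i x)%:E))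
    (g_lip : forall i, lipschitz_at_infinity (g i))
    (S_neq0 : constraint_set Omega g !=set0)
    (qualification :
      ~ minkowski_sum
          (convex_hull (\bigcup_(i in [set: 'I_m]) subdiff_at_infinity (g i)))
          (normal_at_infinity Omega) 0) :
  error_bound_at_infinity Omega g.
Proof.
have [L [rho [L0 rho0 gL]]] := uniform_lipschitz_at_infinity g g_lip.
apply: contrapT => no_bound; apply: qualification.
have multipliers k := far_multipliers Omega g L rho k Omega_closed S_neq0
  L0 rho0 gL no_bound.
have [x /choice[z xz]] := choice multipliers.
exact: (zero_in_sum_at_infinity Omega g L x z xz).
Qed.
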